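(* Every oriented interval catch digraph is a directed acyclic graph, i.e., it contains no directed cycle.
   Context: Digraphs are finite and simple (no loops, no multiple arcs). A digraph $G=(V,E)$ is an interval catch digraph (ICD) if one can assign to each $u\in V$ a closed bounded interval $I_u$ of the real line and a point $p_u\in I_u$ such that for $u,v\in V$: $uv\in E$ if and only if $u\ne v$ and $p_v\in I_u$. An oriented interval catch digraph (oriented ICD) is an ICD in which each edge of the underlying undirected graph has exactly one direction, i.e., there is no pair $u,v$ with both $uv\in E$ and $vu\in E$. *)

(* Defs.v *)
From mathcomp Require Import all_boot all_order all_algebra.
From mathcomp Require Import reals.

Set Implicit Arguments.
Unset Strict Implicit.
Unset Printing Implicit Defensive.

Import Order.TTheory GRing.Theory Num.Theory.

Local Open Scope ring_scope.

Record digraph := Digraph {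
  vertex :> finType;
  arc : rel vertex;
  arc_irrefl : irreflexive arc }.

(* The interval I_u is `[l u, r u]; the condition p u \in I_u forces it to be
   nonempty. *)
Definition icd_representation (R : realType) (G : digraph) (l r p : G -> R)
    : Prop :=
  (forall u : G, p u \in `[l u, r u]) /\
  (forall u v : G, arc u v <-> u <> v /\ p v \in `[l u, r u]).

Definition icd (R : realType) (G : digraph) : Prop :=
  exists l r p : G -> R, icd_representation l r p.

Definition oriented (G : digraph) : Prop :=
  ~ exists u v : G, arc u v /\ arc v u.

Definition oriented_icd (R : realType) (G : digraph) : Prop :=
  icd R G /\ oriented G.

Definition directed_cycle (G : digraph) (c : seq G) : Prop :=
  c <> [::] /\ ucycle (@arc G) c.

Definition dag (G : digraph) : Prop :=
  ~ exists c : seq G, directed_cycle c.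

(* Main.v *)
(** In a closed walk, let [x] be the vertex with leftmost point, [w] its
    predecessor and [y] its successor.  Both [p w] and [p y] lie to the right
    of [p x].  If [p y <= p w], then [p y] lies in the interval of [w], so [x]
    can be cut out of the walk; otherwise [p w] lies in the interval of [x],
    which makes [x] and [w] mutually adjacent. *)
Require Import Defs.
From mathcomp Require Import all_boot all_order all_algebra.
From mathcomp Require Import reals.

Import Order.TTheory.

Local Open Scope ring_scope.

Lemma icd_shortcut {R : realType} {G : digraph} {l r p : G -> R} {w x y : G} :
  icd_representation l r p -> oriented G -> Defs.arc w x -> Defs.arc x y ->
  p x <= p w -> p x <= p y -> Defs.arc w y.
Proof.
move=> [p_in arcP] orG wx xy le_xw le_xy.
(* If [w = y], the arcs [w x] and [x y] are opposite, against orientedness. *)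
have [wy|neq_wy] := eqVneq w y.
  by case: orG; exists w, x; rewrite {2}wy.
have [_] := (arcP w x).1 wx; rewrite in_itv /= => /andP[lwx _].
have [_] := (arcP x y).1 xy; rewrite in_itv /= => /andP[_ yrx].
have := p_in w; rewrite in_itv /= => /andP[_ wrw].
have := p_in x; rewrite in_itv /= => /andP[lxx _].
have [le_yw|lt_wy] := leP (p y) (p w).
  apply/arcP; split; first exact/eqP.
  by rewrite in_itv /= (le_trans lwx le_xy) (le_trans le_yw wrw).
case: orG; exists w, x; split=> //; apply/arcP; split.
  by move=> xw; move: wx; rewrite xw arc_irrefl.
by rewrite in_itv /= (le_trans lxx le_xw) (le_trans (ltW lt_wy) yrx).
Qed.

(** Strong induction on length: cutting out the leftmost vertex leaves a shorter closed walk, which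
    is still nonempty because there are no loops. *)
Lemma oriented_icd_acyclic {R : realType} {G : digraph} {l r p : G -> R}
    {c : seq G} :
  icd_representation l r p -> oriented G -> cycle (@Defs.arc G) c -> c = [::].
Proof.
move=> repG orG; have [n] := ubnP (size c); elim: n c => // n IHn [//|x0 c] lt_n.
have [x x_c min_x] := @arg_minP _ _ _ x0 (mem (x0 :: c)) p (mem_head _ _).
(* Rotating [x] to the head makes its predecessor the last entry of the walk. *)
have [i s rot_c] := rot_to x_c.
rewrite -(rot_cycle i) rot_c.
have size_s : size s = size c.
  by apply: succn_inj; rewrite -[LHS]/(size (x :: s)) -rot_c size_rot.
have min_s z : z \in x :: s -> p x <= p z.
  by rewrite -rot_c mem_rot; apply: min_x.
case: s => [|y t] in rot_c size_s min_s *; first by rewrite /= arc_irrefl.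
rewrite /= rcons_path => /and3P[xy path_t wx].
(* [y :: t] is the walk with [x] cut out. *)
suff: y :: t = [::] by [].
apply: IHn; first by rewrite size_s.
rewrite /= rcons_path path_t /=.
apply: (icd_shortcut repG orG wx xy); apply: min_s.
  by rewrite inE mem_last orbT.
by rewrite !inE eqxx orbT.
Qed.

Theorem theorem6p1 (R : realType) (G : digraph) :
  oriented_icd R G -> dag G.
Proof.
move=> [[l [r [p repG]]] orG] [c [c_neq0 /andP[cyc_c _]]].
exact: c_neq0 (oriented_icd_acyclic repG orG cyc_c).
Qed.
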